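(* Let $R \to S$ be a faithfully flat Ohm-Rush algebra. Assume $R$ is Noetherian. Then the following are equivalent: (1) $S$ is a weak content $R$-algebra. (2) $S$ is a semicontent $R$-algebra. (3) $R \to S$ is residually McCoy. (4) $R \to S$ is residually McCoy for radical ideals. (5) $R \to S$ is residually McCoy for prime ideals.
   Context: All rings are commutative with identity. Let $R \to S$ be a ring homomorphism. For $f \in S$, the content $c(f)$ is the intersection of all ideals $I$ of $R$ such that $f \in IS$. The algebra $R \to S$ is called Ohm-Rush if $f \in c(f)S$ for every $f \in S$. An Ohm-Rush algebra is a weak content algebra if for all $f,g\in S$ the ideals $c(fg)$ and $c(f)c(g)$ of $R$ have the same radical. A semicontent algebra is a faithfully flat Ohm-Rush algebra $R \to S$ such that for any multiplicative subset $W \subseteq R$ and any $f,g \in S$ with $c(f) \cap W \neq \emptyset$, one has $c(fg)_W = c(g)_W$ (localizations at $W$, as ideals of $W^{-1}R$). An Ohm-Rush algebra $R \to S$ is McCoy if whenever $f,g \in S$ with $fg=0$ and $g \neq 0$, there is some nonzero $r \in R$ with $r\,c(f) = 0$. It is known that if $R \to S$ is Ohm-Rush and $I$ is an ideal of $R$, then $R/I \to S/IS$ is Ohm-Rush. For a set $\mathcal{I}$ of ideals of $R$, an Ohm-Rush algebra $R \to S$ is residually McCoy for $\mathcal{I}$ if for every $I \in \mathcal{I}$ the algebra $R/I \to S/IS$ is McCoy (where content is computed with respect to $R/I \to S/IS$). ''Residually McCoy for prime (resp. radical) ideals'' means that $\mathcal{I}$ is the set of all prime (resp. radical) ideals of $R$;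 ''residually McCoy'' means that $\mathcal{I}$ is the set of all ideals of $R$. *)

(* Defs.v *)
From HB Require Import structures.
From mathcomp Require Import all_boot all_algebra.
From mathcomp Require Import generic_quotient ring_quotient ring.
From mathcomp Require Import freeg.
From mathcomp Require Import boolp classical_sets.

Set Implicit Arguments.
Unset Strict Implicit.
Unset Printing Implicit Defensive.

Import GRing.Theory.
Local Open Scope ring_scope.
Local Open Scope quotient_scope.
Local Open Scope classical_set_scope.

(* Rings are [comPzRingType]s, so that the zero ring is a ring (it occurs     *)
(* here as R/R). Ideals are not assumed proper; note that the [idealr]s of    *)
(* the library are, and that they only exist over nontrivial rings.           *)

Record ideal (R : comPzRingType) := Ideal {
  ideal_set :> R -> Prop;
  ideal0 : ideal_set 0;
  idealD : forall x y, ideal_set x -> ideal_set y -> ideal_set (x + y);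
  idealM : forall a x, ideal_set x -> ideal_set (a * x)
}.

Section Ideals.
Context {R : comPzRingType}.
Implicit Types (A : set R) (I J : ideal R).

Definition span_set A : set R :=
  [set x | exists2 s : seq (R * R),
    {in s, forall p, A p.2} & x = \sum_(p <- s) p.1 * p.2].

Fact span_set0 A : span_set A 0.
Proof. by exists [::] => //; rewrite big_nil. Qed.

Fact span_setD A x y : span_set A x -> span_set A y -> span_set A (x + y).
Proof.
move=> [s As ->] [t At ->]; exists (s ++ t); last by rewrite big_cat.
by move=> p; rewrite mem_cat => /orP[/As|/At].
Qed.

Fact span_setM A a x : span_set A x -> span_set A (a * x).
Proof.
move=> [s As ->]; exists [seq (a * p.1, p.2) | p <- s].
  by move=> _ /mapP[p /As Ap ->].
by rewrite big_map mulr_sumr; apply: eq_bigr => p _; rewrite mulrA.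
Qed.

Definition ideal_span A : ideal R :=
  Ideal (span_set0 A) (@span_setD A) (@span_setM A).

Definition ideal_mul I J : ideal R :=
  ideal_span [set x | exists a b, [/\ I a, J b & x = a * b]].

(* n = 0 is harmless: I (x ^+ 0) forces I = R. *)
Definition radical I : set R := [set x | exists n, I (x ^+ n)].

Definition radical_ideal I : Prop := radical I = I :> set R.

Definition prime_ideal I : Prop :=
  ~ I 1 /\ forall a b, I (a * b) -> I a \/ I b.

End Ideals.

Definition noetherian (R : comPzRingType) : Prop :=
  forall I : ideal R, exists s : seq R, I = ideal_span [set` s] :> set R.

Section QuotientRing.
Context {R : comPzRingType} (I : ideal R).

Definition ideal_pred (x : R) : bool := `[< I x >].

Lemma ideal_predE x : (x \in ideal_pred) = `[< I x >]. Proof. by []. Qed.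

Fact ideal_pred_zmod_closed : zmod_closed ideal_pred.
Proof.
split=> [|x y /asboolP Ix /asboolP Iy]; apply/asboolP; first exact: ideal0.
by rewrite -mulN1r; apply: idealD => //; apply: idealM.
Qed.

HB.instance Definition _ :=
  GRing.isZmodClosed.Build R ideal_pred ideal_pred_zmod_closed.

Definition quo : Type := {ideal_quot GRing.ZmodClosed.clone R ideal_pred _}.

HB.instance Definition _ := Quotient.on quo.
HB.instance Definition _ := GRing.Zmodule.on quo.

Definition to_quo (x : R) : quo := \pi_quo x.

Lemma to_quo_eq x y : to_quo x = to_quo y <-> I (x - y).
Proof.
split=> [/eqP|Ixy]; last (apply/eqP; move: Ixy => /asboolP).
  by rewrite -Quotient.idealrBE => /asboolP.
by rewrite -ideal_predE Quotient.idealrBE.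
Qed.

Lemma to_quo_repr (x : quo) : to_quo (repr x) = x. Proof. exact: reprK. Qed.

Fact to_quo_zmod_morphism : zmod_morphism to_quo.
Proof. exact: pi_is_zmod_morphism. Qed.

HB.instance Definition _ :=
  GRing.isZmodMorphism.Build R quo to_quo to_quo_zmod_morphism.

Definition quo_one : quo := to_quo 1.
Definition quo_mul (x y : quo) : quo := to_quo (repr x * repr y).

Fact quo_mulE x y : quo_mul (to_quo x) (to_quo y) = to_quo (x * y).
Proof.
apply/to_quo_eq.
have Hx : I (repr (to_quo x) - x) by apply/to_quo_eq; exact: to_quo_repr.
have Hy : I (repr (to_quo y) - y) by apply/to_quo_eq; exact: to_quo_repr.
set a := repr _ in Hx *; set b := repr _ in Hy *.
have -> : a * b - x * y = b * (a - x) + x * (b - y) by ring.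
by apply: idealD; apply: idealM.
Qed.

Fact quo_mulA : associative quo_mul.
Proof.
move=> x y z; rewrite -[x]to_quo_repr -[y]to_quo_repr -[z]to_quo_repr.
by rewrite !quo_mulE mulrA.
Qed.

Fact quo_mulC : commutative quo_mul.
Proof. by move=> x y; rewrite /quo_mul mulrC. Qed.

Fact quo_mul1 : left_id quo_one quo_mul.
Proof. by move=> x; rewrite -[x]to_quo_repr quo_mulE mul1r. Qed.

Fact quo_mulDl : left_distributive quo_mul +%R.
Proof.
move=> x y z; rewrite -[x]to_quo_repr -[y]to_quo_repr -[z]to_quo_repr.
by rewrite -raddfD !quo_mulE -raddfD mulrDl.
Qed.

HB.instance Definition _ := GRing.Zmodule_isComPzRing.Build quo
  quo_mulA quo_mulC quo_mul1 quo_mulDl.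

Fact to_quo_monoid_morphism : monoid_morphism to_quo.
Proof. by split=> // x y; exact/esym/quo_mulE. Qed.

HB.instance Definition _ :=
  GRing.isMonoidMorphism.Build R quo to_quo to_quo_monoid_morphism.

End QuotientRing.

Section Localization.
Context {R : comPzRingType}.

Record multset := Multset {
  multset_set :> R -> Prop;
  multset1 : multset_set 1;
  multsetM : forall x y, multset_set x -> multset_set y -> multset_set (x * y)
}.

Variable W : multset.

Definition denom : Type := {w : R | `[< W w >]}.
HB.instance Definition _ := SubChoice.on denom.

Definition den (w : denom) : R := val w.

Lemma denomP (w : denom) : W (den w).
Proof. by apply/asboolP; exact: (valP w). Qed.

Definition denom1 : denom := Sub 1 (introT (asboolP _) (multset1 W)).
Definition denomM (v w : denom) : denom :=
  Sub (den v * den w) (introT (asboolP _) (multsetM (denomP v) (denomP w))).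

Fact denE : (den denom1 = 1) * (forall v w, den (denomM v w) = den v * den w).
Proof. by []. Qed.

(* W may contain zero divisors, or even 0, whence the factor u. *)
Definition frac_equiv (x y : R * denom) : bool :=
  `[< exists2 u, W u & u * (x.1 * den y.2) = u * (y.1 * den x.2) >].

Fact frac_equiv_class : equiv_class_of frac_equiv.
Proof.
split=> [x|x y|y x z].
- by apply/asboolP; exists 1 => //; exact: multset1.
- by apply/asboolP/asboolP => -[u Wu e]; exists u.
- case: x y z => [a v] [b w] [c t] /asboolP[/= u Wu e] /asboolP[/= u' Wu' e'].
  apply/asboolP; exists (u * u' * den w) => /=.
    exact: multsetM (multsetM Wu Wu') (denomP w).
  have -> : u * u' * den w * (a * den t) = u' * den t * (u * (a * den w)).
    by ring.
  rewrite e.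
  have -> : u' * den t * (u * (b * den v)) = u * den v * (u' * (b * den t)).
    by ring.
  by rewrite e'; ring.
Qed.

Canonical frac_equiv_equiv := EquivRelPack frac_equiv_class.
Canonical frac_equiv_encModRel := defaultEncModRel frac_equiv.

Definition localization : Type := {eq_quot frac_equiv}.
HB.instance Definition _ := EqQuotient.on localization.
HB.instance Definition _ := Choice.on localization.

Definition frac (a : R) (w : denom) : localization := \pi_localization (a, w).

Lemma frac_eq a v b w : frac a v = frac b w <->
  exists2 u, W u & u * (a * den w) = u * (b * den v).
Proof.
split=> [/eqP|e]; last apply/eqP; rewrite piE.
  by move=> /asboolP.
exact/asboolP.
Qed.

Lemma frac_ind (P : localization -> Prop) :
  (forall a w, P (frac a w)) -> forall x, P x.
Proof. by move=> H x; rewrite -[x]reprK; case: (repr x) => a w; exact: H. Qed.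

Definition loc_zero := frac 0 denom1.
Definition loc_one := frac 1 denom1.
Definition loc_opp (x : localization) := frac (- (repr x).1) (repr x).2.
Definition loc_add (x y : localization) :=
  frac ((repr x).1 * den (repr y).2 + (repr y).1 * den (repr x).2)
       (denomM (repr x).2 (repr y).2).
Definition loc_mul (x y : localization) :=
  frac ((repr x).1 * (repr y).1) (denomM (repr x).2 (repr y).2).

Fact frac_repr a w : exists2 u, W u &
  u * ((repr (frac a w)).1 * den w) = u * (a * den (repr (frac a w)).2).
Proof.
apply/frac_eq; rewrite -[RHS]reprK /frac.
by case: (repr (\pi_localization (a, w))).
Qed.

Fact loc_oppE a w : loc_opp (frac a w) = frac (- a) w.
Proof.
have [u Wu e] := frac_repr a w; apply/frac_eq; exists u => //.
by rewrite !mulNr !mulrN e.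
Qed.

Fact loc_addE a v b w :
  loc_add (frac a v) (frac b w) =
  frac (a * den w + b * den v) (denomM v w).
Proof.
have [u Wu e] := frac_repr a v; have [t Wt f] := frac_repr b w.
apply/frac_eq; exists (u * t); first exact: multsetM.
rewrite !denE; move: e f.
case: (repr (frac a v)) => a' v'; case: (repr (frac b w)) => b' w' /= e f.
transitivity (t * den w * den w' * (u * (a' * den v))
              + u * den v * den v' * (t * (b' * den w))); first by ring.
by rewrite e f; ring.
Qed.

Fact loc_mulE a v b w :
  loc_mul (frac a v) (frac b w) = frac (a * b) (denomM v w).
Proof.
have [u Wu e] := frac_repr a v; have [t Wt f] := frac_repr b w.
apply/frac_eq; exists (u * t); first exact: multsetM.
rewrite !denE; move: e f.
case: (repr (frac a v)) => a' v'; case: (repr (frac b w)) => b' w' /= e f.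
transitivity ((u * (a' * den v)) * (t * (b' * den w))); first by ring.
by rewrite e f; ring.
Qed.

Fact frac_eq1 a v b w : a * den w = b * den v -> frac a v = frac b w.
Proof. by move=> e; apply/frac_eq; exists 1; rewrite ?e //; exact: multset1. Qed.

Fact loc_addA : associative loc_add.
Proof.
elim/frac_ind=> a u; elim/frac_ind=> b v; elim/frac_ind=> c w.
by rewrite !loc_addE; apply: frac_eq1; rewrite !denE; ring.
Qed.

Fact loc_addC : commutative loc_add.
Proof.
elim/frac_ind=> a u; elim/frac_ind=> b v.
by rewrite !loc_addE; apply: frac_eq1; rewrite !denE; ring.
Qed.

Fact loc_add0 : left_id loc_zero loc_add.
Proof.
elim/frac_ind=> a u.
by rewrite !loc_addE; apply: frac_eq1; rewrite !denE; ring.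
Qed.

Fact loc_addN : left_inverse loc_zero loc_opp loc_add.
Proof.
elim/frac_ind=> a u.
by rewrite loc_oppE loc_addE; apply: frac_eq1; rewrite !denE; ring.
Qed.

HB.instance Definition _ := GRing.isZmodule.Build localization
  loc_addA loc_addC loc_add0 loc_addN.

Fact loc_mulA : associative loc_mul.
Proof.
elim/frac_ind=> a u; elim/frac_ind=> b v; elim/frac_ind=> c w.
by rewrite !loc_mulE; apply: frac_eq1; rewrite !denE; ring.
Qed.

Fact loc_mulC : commutative loc_mul.
Proof.
elim/frac_ind=> a u; elim/frac_ind=> b v.
by rewrite !loc_mulE; apply: frac_eq1; rewrite !denE; ring.
Qed.

Fact loc_mul1 : left_id loc_one loc_mul.
Proof.
elim/frac_ind=> a u.
by rewrite !loc_mulE; apply: frac_eq1; rewrite !denE; ring.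
Qed.

Fact loc_mulDl : left_distributive loc_mul +%R.
Proof.
elim/frac_ind=> a u; elim/frac_ind=> b v; elim/frac_ind=> c w.
rewrite -[LHS]/(loc_mul (loc_add (frac a u) (frac b v)) (frac c w)).
rewrite -[RHS]/(loc_add (loc_mul (frac a u) (frac c w))
                        (loc_mul (frac b v) (frac c w))).
rewrite loc_addE !loc_mulE loc_addE.
by apply: frac_eq1; rewrite !denE; ring.
Qed.

HB.instance Definition _ := GRing.Zmodule_isComPzRing.Build localization
  loc_mulA loc_mulC loc_mul1 loc_mulDl.

Section IdealLocalization.
Variable I : ideal R.

Definition loc_set : set localization :=
  [set x | exists a w, I a /\ x = frac a w].

Fact loc_set0 : loc_set 0.
Proof. by exists 0, denom1; split=> //; exact: ideal0. Qed.

Fact loc_setD x y : loc_set x -> loc_set y -> loc_set (x + y).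
Proof.
move=> [a [v [Ia ->]]] [b [w [Ib ->]]].
exists (a * den w + b * den v), (denomM v w); split; last exact: loc_addE.
by rewrite ![_ * den _]mulrC; apply: idealD; apply: idealM.
Qed.

Fact loc_setM z x : loc_set x -> loc_set (z * x).
Proof.
elim/frac_ind: z => b v [a [w [Ia ->]]].
by exists (b * a), (denomM v w); split; [exact: idealM | exact: loc_mulE].
Qed.

Definition ideal_loc : ideal localization := Ideal loc_set0 loc_setD loc_setM.

End IdealLocalization.

End Localization.

Arguments multset : clear implicits.

Section Tensor.
Context {R : comPzRingType}.

Inductive tensor_rel (M N : lmodType R) : {freeg (M * N)} -> Prop :=
| TensorRel0 : tensor_rel 0
| TensorRelB s t : tensor_rel s -> tensor_rel t -> tensor_rel (s - t)
| TensorRelDl m m' n :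
    tensor_rel (<< (m + m', n) >> - << (m, n) >> - << (m', n) >>)
| TensorRelDr m n n' :
    tensor_rel (<< (m, n + n') >> - << (m, n) >> - << (m, n') >>)
| TensorRelZ a m n :
    tensor_rel (<< (a *: m, n) >> - << (m, a *: n) >>).

Definition tensor_pred (M N : lmodType R) (t : {freeg (M * N)}) : bool :=
  `[< tensor_rel t >].

Fact tensor_pred_zmod_closed (M N : lmodType R) :
  zmod_closed (@tensor_pred M N).
Proof.
split=> [|s t /asboolP Hs /asboolP Ht]; apply/asboolP.
  exact: TensorRel0.
exact: TensorRelB.
Qed.

HB.instance Definition _ (M N : lmodType R) :=
  GRing.isZmodClosed.Build {freeg (M * N)} (@tensor_pred M N)
    (@tensor_pred_zmod_closed M N).

(* M \otimes_R N as an abelian group: Z[M x N] modulo the bilinear relations.  *)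
(* Its R-module structure plays no role in the exactness of sequences.        *)
Definition tensor (M N : lmodType R) : Type := 
  {ideal_quot GRing.ZmodClosed.clone _ (@tensor_pred M N) _}.

HB.instance Definition _ M N := Quotient.on (tensor M N).
HB.instance Definition _ M N := GRing.Zmodule.on (tensor M N).

Definition to_tensor (M N : lmodType R) (t : {freeg (M * N)}) : tensor M N :=
  \pi_(tensor M N) t.

Lemma to_tensor_eq (M N : lmodType R) (s t : {freeg (M * N)}) :
  to_tensor s = to_tensor t <-> tensor_rel (s - t).
Proof.
split=> [/eqP|Ht]; last (apply/eqP; move: Ht => /asboolP).
  by rewrite -Quotient.idealrBE => /asboolP.
by rewrite -Quotient.idealrBE.
Qed.

Lemma to_tensor_repr (M N : lmodType R) (x : tensor M N) :
  to_tensor (repr x) = x.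
Proof. exact: reprK. Qed.

Fact to_tensor_zmod_morphism (M N : lmodType R) :
  zmod_morphism (@to_tensor M N).
Proof. exact: pi_is_zmod_morphism. Qed.

HB.instance Definition _ (M N : lmodType R) :=
  GRing.isZmodMorphism.Build {freeg (M * N)} (tensor M N) (@to_tensor M N)
    (@to_tensor_zmod_morphism M N).

Definition pure (M N : lmodType R) (m : M) (n : N) : tensor M N :=
  to_tensor << (m, n) >>.

Section TensorMap.
Variables (M M' N : lmodType R) (f : {linear M -> M'}).

Definition freeg_tensor_map : {freeg (M * N)} -> {freeg (M' * N)} :=
  fglift (fun p => << (f p.1, p.2) >>).

Fact freeg_tensor_map_zmod_morphism : zmod_morphism freeg_tensor_map.
Proof. exact: lift_is_additive. Qed.

HB.instance Definition _ :=
  GRing.isZmodMorphism.Build {freeg (M * N)} {freeg (M' * N)} freeg_tensor_map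
    freeg_tensor_map_zmod_morphism.

Definition tensor_map (x : tensor M N) : tensor M' N :=
  to_tensor (freeg_tensor_map (repr x)).

Lemma freeg_tensor_map1 m n : freeg_tensor_map << (m, n) >> = << (f m, n) >>.
Proof. by rewrite /freeg_tensor_map liftU scale1r. Qed.

Lemma freeg_tensor_map_rel t :
  tensor_rel t -> tensor_rel (freeg_tensor_map t).
Proof.
elim=> [|s {}t _ IHs _ IHt|m m' n|m n n'|a m n].
- by rewrite raddf0; exact: TensorRel0.
- by rewrite raddfB; exact: TensorRelB.
- by rewrite !raddfB /= !freeg_tensor_map1 linearD; exact: TensorRelDl.
- by rewrite !raddfB /= !freeg_tensor_map1; exact: TensorRelDr.
- by rewrite !raddfB /= !freeg_tensor_map1 linearZ; exact: TensorRelZ.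
Qed.

Lemma tensor_map_to_tensor t :
  tensor_map (to_tensor t) = to_tensor (freeg_tensor_map t).
Proof.
apply/to_tensor_eq; rewrite -raddfB; apply: freeg_tensor_map_rel.
by apply/to_tensor_eq; exact: to_tensor_repr.
Qed.

Lemma tensor_map_pure m n : tensor_map (pure m n) = pure (f m) n.
Proof. by rewrite /pure tensor_map_to_tensor freeg_tensor_map1. Qed.

Fact tensor_map_zmod_morphism : zmod_morphism tensor_map.
Proof.
move=> x y; rewrite -[x]to_tensor_repr -[y]to_tensor_repr -raddfB.
by rewrite !tensor_map_to_tensor !raddfB.
Qed.

HB.instance Definition _ :=
  GRing.isZmodMorphism.Build (tensor M N) (tensor M' N) tensor_map
    tensor_map_zmod_morphism.

End TensorMap.

End Tensor.

Arguments tensor_map {R M M'} N f.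

Definition exact_at (A B C : zmodType) (f : A -> B) (g : B -> C) : Prop :=
  range f = [set y | g y = 0].

Section Algebras.
Context {R S : comPzRingType} (phi : {rmorphism R -> S}).

Definition restr of {rmorphism R -> S} : Type := S.
HB.instance Definition _ := GRing.Zmodule.on (restr phi).

Definition restr_scale (a : R) (s : restr phi) : restr phi := phi a * (s : S).

Fact restr_scaleA a b s :
  restr_scale a (restr_scale b s) = restr_scale (a * b) s.
Proof. by rewrite /restr_scale rmorphM mulrA. Qed.

Fact restr_scale1 : left_id 1 restr_scale.
Proof. by move=> s; rewrite /restr_scale rmorph1 mul1r. Qed.

Fact restr_scaleDr : right_distributive restr_scale +%R.
Proof. by move=> a s t; exact: mulrDr. Qed.

Fact restr_scaleDl s : {morph restr_scale^~ s : a b / a + b}.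
Proof. by move=> a b; rewrite /restr_scale rmorphD; exact: mulrDl. Qed.

HB.instance Definition _ := GRing.Zmodule_isLmodule.Build R (restr phi)
  restr_scaleA restr_scale1 restr_scaleDr restr_scaleDl.

(* A sequence M1 -> M2 -> M3 of R-modules is exact iff                        *)
(* M1 \otimes S -> M2 \otimes S -> M3 \otimes S is exact.                     *)
Definition faithfully_flat : Prop :=
  forall (M1 M2 M3 : lmodType R)
    (f : {linear M1 -> M2}) (g : {linear M2 -> M3}),
  exact_at f g <->
  exact_at (tensor_map (restr phi) f) (tensor_map (restr phi) g).

Definition ideal_ext (I : ideal R) : ideal S := ideal_span (phi @` I).

Section Content.
Variable f : S.

Definition content_set : set R :=
  \bigcap_(I in [set I : ideal R | ideal_ext I f]) (I : set R).

Fact content_set0 : content_set 0.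
Proof. by move=> I _; exact: ideal0. Qed.

Fact content_setD x y : content_set x -> content_set y -> content_set (x + y).
Proof. by move=> Hx Hy I If; apply: idealD; [exact: Hx | exact: Hy]. Qed.

Fact content_setM a x : content_set x -> content_set (a * x).
Proof. by move=> Hx I If; apply: idealM; exact: Hx. Qed.

Definition content : ideal R := Ideal content_set0 content_setD content_setM.

End Content.

Definition ohm_rush : Prop := forall f : S, ideal_ext (content f) f.

Definition weak_content_algebra : Prop :=
  ohm_rush /\
  forall f g : S,
    radical (content (f * g)) = radical (ideal_mul (content f) (content g)).

Definition semicontent_algebra : Prop :=
  [/\ faithfully_flat, ohm_rush
    & forall (W : multset R) (f g : S),
        (exists2 w, content f w & W w) ->
        ideal_loc W (content (f * g)) = ideal_loc W (content g)
          :> set (localization W)].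

Definition mccoy : Prop :=
  ohm_rush /\
  forall f g : S, f * g = 0 -> g != 0 ->
    exists2 r : R, r != 0 & forall a, content f a -> r * a = 0.

Section QuotientMap.
Variable I : ideal R.

Definition quo_map (x : quo I) : quo (ideal_ext I) :=
  to_quo (ideal_ext I) (phi (repr x)).

Lemma quo_mapE x : quo_map (to_quo I x) = to_quo (ideal_ext I) (phi x).
Proof.
apply/to_quo_eq; rewrite -rmorphB.
set y := (X in phi X); have Iy : I y by apply/to_quo_eq; exact: to_quo_repr.
exists [:: (1, phi y)]; last by rewrite big_seq1 mul1r.
by move=> p; rewrite inE => /eqP -> /=; exists y.
Qed.

Fact quo_map_zmod_morphism : zmod_morphism quo_map.
Proof.
move=> x y; rewrite -[x]to_quo_repr -[y]to_quo_repr.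
by rewrite -rmorphB !quo_mapE !rmorphB.
Qed.

HB.instance Definition _ :=
  GRing.isZmodMorphism.Build (quo I) (quo (ideal_ext I)) quo_map
    quo_map_zmod_morphism.

Fact quo_map_monoid_morphism : monoid_morphism quo_map.
Proof.
split=> [|x y]; first by rewrite -(rmorph1 (to_quo I)) quo_mapE !rmorph1.
rewrite -[x]to_quo_repr -[y]to_quo_repr.
by rewrite -rmorphM !quo_mapE !rmorphM.
Qed.

HB.instance Definition _ :=
  GRing.isMonoidMorphism.Build (quo I) (quo (ideal_ext I)) quo_map
    quo_map_monoid_morphism.

End QuotientMap.

End Algebras.

Arguments quo_map {R S} phi I x.

Definition residually_mccoy_for (R S : comPzRingType)
    (phi : {rmorphism R -> S}) (C : set (ideal R)) : Prop :=
  ohm_rush phi /\ forall I : ideal R, C I -> mccoy (quo_map phi I).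

(* Main.v *)
(* The proof uses flatness only through (I : x)S = (IS : x), and the Ohm-Rush
   property in the form: g lies in IS iff c(g) is contained in I.

   Weak content => semicontent: if fg lies in LS, where L is W-saturated and
   c(f) meets W, then so does g. Otherwise enlarge L to a maximal W-saturated M
   such that g is not in MS, and take x in c(g) \ M. By maximality p = (M : x)
   is a prime missing W, and wg = l + xt for some w in W and l in MS. Then xft
   lies in MS, ft lies in pS, t lies in pS by the weak content property, whence
   wg and g lie in MS.

   Semicontent => residually McCoy: if fg lies in IS and x is in c(g) \ I, choose
   an associated prime p = (I : rx). If c(f) met R \ p, then c(fg) and c(g)
   would agree at p, although c(fg) is contained in I and rx is nonzero in
   (R/I)_p; so rx kills c(f) modulo I.

   McCoy for primes => weak content: a nonzero element of the domain R/p kills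
   only the zero ideal, so McCoy forces c(f) or c(g) into every prime containing
   c(fg). *)
Require Import Defs.
From HB Require Import structures.
From mathcomp Require Import all_boot all_algebra.
From mathcomp Require Import ring freeg.
From mathcomp Require Import boolp classical_sets.

Set Implicit Arguments.
Unset Strict Implicit.
Unset Printing Implicit Defensive.

Import GRing.Theory.
Local Open Scope ring_scope.
Local Open Scope classical_set_scope.

(** * Ideals generated by sets, colon ideals, and zero in a quotient *)

Section IdealLemmas.
Context {R : comPzRingType}.
Implicit Types (A : set R) (I J : ideal R).

Lemma span_set_sub A x : A x -> span_set A x.
Proof.
move=> Ax; exists [:: (1, x)]; rewrite ?big_seq1 ?mul1r //.
by move=> p /[!inE]/eqP->.
Qed.

Lemma span_set_min A J : A `<=` J -> ideal_span A `<=` J.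
Proof.
move=> AJ _ [s As ->]; rewrite big_seq; elim/big_ind: _ => [|x y|p /As/AJ].
- exact: ideal0.
- exact: idealD.
- exact: idealM.
Qed.

Lemma idealB I x y : I x -> I y -> I (x - y).
Proof. by move=> Ix Iy; rewrite -mulN1r; apply/idealD/idealM. Qed.

Lemma idealMr I a x : I x -> I (x * a).
Proof. by rewrite mulrC; exact: idealM. Qed.

Definition zero_ideal : ideal R.
Proof.
by exists [set 0] => [|x y -> ->|a x ->] //=; rewrite ?addr0 ?mulr0.
Defined.

Definition colon_set I x : set R := [set a | I (a * x)].

Fact colon_set0 I x : colon_set I x 0.
Proof. by rewrite /colon_set /= mul0r; exact: ideal0. Qed.

Fact colon_setD I x a b :
  colon_set I x a -> colon_set I x b -> colon_set I x (a + b).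
Proof. by rewrite /colon_set /= mulrDl; exact: idealD. Qed.

Fact colon_setM I x a b : colon_set I x b -> colon_set I x (a * b).
Proof. by rewrite /colon_set /= -mulrA; exact: idealM. Qed.

Definition colon I x : ideal R :=
  Ideal (@colon_set0 I x) (@colon_setD I x) (@colon_setM I x).

Lemma colonE I x a : colon I x a = I (a * x).
Proof. by []. Qed.

Lemma to_quo0P I a : to_quo I a = 0 <-> I a.
Proof. by rewrite -(raddf0 (to_quo I)) to_quo_eq subr0. Qed.

End IdealLemmas.

Arguments zero_ideal : clear implicits.

(** * Extension of ideals along a ring homomorphism *)

Section Extension.
Context {R S : comPzRingType} (phi : {rmorphism R -> S}).
Implicit Types (I J : ideal R) (Q : ideal S).

Lemma ideal_ext_sub I a : I a -> ideal_ext phi I (phi a).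
Proof. by move=> Ia; apply: span_set_sub; exists a. Qed.

Lemma ideal_ext_ind I (P : S -> Prop) :
  P 0 -> (forall s t, P s -> P t -> P (s + t)) ->
  (forall a u, I a -> P (u * phi a)) -> forall s, ideal_ext phi I s -> P s.
Proof.
move=> P0 PD PM _ [r Ir ->]; rewrite big_seq; elim/big_ind: _ => // -[u s] /Ir.
by case=> a Ia /= <-; exact: PM.
Qed.

Lemma ideal_ext_min I Q :
  (forall a, I a -> Q (phi a)) -> ideal_ext phi I `<=` Q.
Proof. by move=> IQ; apply: span_set_min => _ [a /IQ Qa <-]. Qed.

Lemma ideal_extS I J : I `<=` J -> ideal_ext phi I `<=` ideal_ext phi J.
Proof. by move=> IJ; apply: ideal_ext_min => a /IJ/ideal_ext_sub. Qed.

End Extension.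

(** * Flatness: extension commutes with colon by an element *)

Section SubmoduleOfIdeal.
Context {R : comPzRingType} (I : ideal R).

Definition submod_pred : {pred R^o} := fun x => `[< I x >].

Fact submod_pred_closed : submod_closed submod_pred.
Proof.
split=> [|a x y /asboolP Ix /asboolP Iy]; apply/asboolP; first exact: ideal0.
exact/idealD/Iy/idealM.
Qed.

HB.instance Definition _ :=
  GRing.isSubmodClosed.Build R R^o submod_pred submod_pred_closed.

(** An ideal is made into an [R]-module so that its inclusion into [R] can be tensored with [S]. *)
Definition ideal_module : Type := {x : R^o | x \in submod_pred}.
HB.instance Definition _ := SubChoice.on ideal_module.
HB.instance Definition _ :=
  [SubChoice_isSubLmodule of ideal_module by <:].

End SubmoduleOfIdeal.

Section Flatness.
Context {R S : comPzRingType} (phi : {rmorphism R -> S}).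

Lemma pureDr (M N : lmodType R) (m : M) (n n' : N) :
  pure m (n + n') = pure m n + pure m n'.
Proof.
apply/subr0_eq; rewrite opprD addrA -!raddfB -[RHS](raddf0 (@to_tensor R M N)).
by apply/to_tensor_eq; rewrite subr0; exact: TensorRelDr.
Qed.

Lemma pureZ (M N : lmodType R) a (m : M) (n : N) :
  pure (a *: m) n = pure m (a *: n).
Proof. exact/to_tensor_eq/TensorRelZ. Qed.

Lemma pureDl (M N : lmodType R) (m m' : M) (n : N) :
  pure (m + m') n = pure m n + pure m' n.
Proof.
apply/subr0_eq; rewrite opprD addrA -!raddfB -[RHS](raddf0 (@to_tensor R M N)).
by apply/to_tensor_eq; rewrite subr0; exact: TensorRelDl.
Qed.

Lemma pure0l (M N : lmodType R) (n : N) : pure (0 : M) n = 0.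
Proof. by apply: (addrI (pure 0 n)); rewrite -pureDl !addr0. Qed.

Lemma pure0r (M N : lmodType R) (m : M) : pure m (0 : N) = 0.
Proof. by apply: (addrI (pure m 0)); rewrite -pureDr !addr0. Qed.

(** The multiplication map from the tensor product of [R] and [S] to [S], given on formal sums;
    [tensor_eval_rel] lets it descend to tensors. *)
Definition tensor_eval : {freeg (R^o * restr phi)} -> S :=
  fglift (fun p => phi p.1 * p.2 : zmodule S).

Fact tensor_eval_zmod_morphism : zmod_morphism tensor_eval.
Proof. exact: (@lift_is_additive int _ (zmodule S)). Qed.

HB.instance Definition _ :=
  GRing.isZmodMorphism.Build {freeg (R^o * restr phi)} S tensor_eval
    tensor_eval_zmod_morphism.

Lemma tensor_eval1 a s : tensor_eval << (a, s) >> = phi a * s.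
Proof. by rewrite /tensor_eval liftU scale1r. Qed.

Lemma tensor_eval_rel t : tensor_rel t -> tensor_eval t = 0.
Proof.
elim=> [|s {}t _ IHs _ IHt|m m' n|m n n'|a m n];
  rewrite ?raddf0 ?raddfB ?raddfB //=.
- by rewrite IHs IHt subrr.
- by rewrite !tensor_eval1 rmorphD mulrDl -addrA -opprD subrr.
- by rewrite !tensor_eval1 mulrDr -addrA -opprD subrr.
- rewrite !tensor_eval1 /GRing.scale /= /restr_scale rmorphM.
  by rewrite mulrCA mulrA subrr.
Qed.


Lemma tensor_eval_image (I : ideal R) (M : lmodType R) (f : {linear M -> R^o})
    (t : {freeg (M * restr phi)}) :
  (forall m, I (f m)) -> ideal_ext phi I (tensor_eval (freeg_tensor_map f t)).
Proof.
move=> If; elim/freeg_ind_dom0: t => [|k [m s] t _ _ It].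
  by rewrite !raddf0; exact: ideal0.
rewrite !raddfD; apply: idealD => //.
have E : tensor_eval (freeg_tensor_map f << (m, s) >>) = phi (f m) * s.
  by rewrite freeg_tensor_map1 tensor_eval1.
rewrite -[k]intz -freegU_mulz !raddfMz [X in X *~ _]E -mulrzl [phi _ * _]mulrC.
rewrite mulrA; exact/idealM/ideal_ext_sub/If.
Qed.

(** Multiplication by [x] from [R] to [R/L], whose kernel is [(L : x)]. *)
Definition colon_map (L : ideal R) (x : R) (a : R^o) : restr (to_quo L) :=
  to_quo L (a * x).

Fact colon_map_linear L x : linear (colon_map L x).
Proof.
move=> k a b; rewrite /colon_map mulrDl raddfD; congr (_ + _).
by rewrite -mulrA [LHS]rmorphM.
Qed.

HB.instance Definition _ L x :=
  GRing.isLinear.Build R R^o (restr (to_quo L)) _ (colon_map L x)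
    (colon_map_linear L x).

Hypothesis phi_flat : faithfully_flat phi.

Lemma colon_exact L x :
  exact_at (\val : ideal_module (colon L x) -> R^o) (colon_map L x).
Proof.
apply/seteqP; split=> [_ [[a /= La] _ <-]|a /= La].
  by apply/to_quo0P; exact/asboolP.
have {}La : a \in submod_pred (colon L x).
  by apply/asboolP; rewrite colonE; exact/to_quo0P.
by exists (Sub a La).
Qed.

(** In a term [u * phi a] with [a] in [L], the scalar [a] moves across the tensor sign and kills the
    class of 1 in [R/L]. *)
Lemma pure_quo_ext L s :
  ideal_ext phi L s -> pure (1 : restr (to_quo L)) (s : restr phi) = 0.
Proof.
move: s; apply: ideal_ext_ind => [|y z y0 z0|a u La].
- exact: pure0r.
- by rewrite (@pureDr (restr (to_quo L)) (restr phi)) y0 z0 addr0.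
have -> : u * phi a = a *: (u : restr phi) by rewrite mulrC.
rewrite -pureZ; have -> : a *: (1 : restr (to_quo L)) = 0; last exact: pure0l.
rewrite /GRing.scale /= /restr_scale [LHS]mulr1; exact/to_quo0P.
Qed.

(** Tensoring the exact sequence [(L : x) -> R -> R/L] with [S] keeps it exact. The tensor of 1 and
    [t] goes to that of 1 and [phi x * t], which is 0, so it comes from [(L : x)]; multiplying out
    puts [t] in the extension of [(L : x)]. *)
Lemma ideal_ext_colon L x t :
  ideal_ext phi L (phi x * t) -> ideal_ext phi (colon L x) t.
Proof.
move=> Lxt; pose f : {linear ideal_module (colon L x) -> R^o} := \val.
have /(_ (colon_exact L x)) := (phi_flat f (colon_map L x)).1.
move=> /seteqP[_ /(_ (pure (1 : R^o) (t : restr phi)))] [].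
  rewrite /= tensor_map_pure /= /colon_map (mul1r (x : R)).
  have -> : to_quo L x = x *: (1 : restr (to_quo L)).
    by rewrite /GRing.scale /= /restr_scale mulr1.
  by rewrite pureZ; exact: pure_quo_ext.
move=> z _; rewrite -[z]to_tensor_repr tensor_map_to_tensor => /to_tensor_eq.
move=> /tensor_eval_rel; rewrite raddfB => /subr0_eq evz.
have <- : tensor_eval << (1 : R^o, t : restr phi) >> = t.
  by rewrite tensor_eval1 rmorph1 mul1r.
rewrite -[X in _ X]evz.
by apply: tensor_eval_image => -[a La]; exact/asboolP.
Qed.

End Flatness.

(** * Maximal ideals with a given property, saturation, and primes *)

Section NoetherianIdeals.
Context {R : comPzRingType}.
Implicit Types (I J M p : ideal R) (W : multset R).

(** Without a maximal element, a choice function yields a strictly increasing chain; its union is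
    finitely generated, so some stage already contains it. *)
Lemma noetherian_max (P : ideal R -> Prop) I0 : noetherian R -> P I0 ->
  exists2 M, P M & forall J, P J -> M `<=` J -> J `<=` M.
Proof.
move=> noeth PI0; apply: contrapT => noM.
have /choice[g gP] (I : {I | P I}) : exists J : {J | P J},
    sval I `<=` sval J /\ ~ (sval J `<=` sval I).
  apply: contrapT => noJ; apply: noM; exists (sval I); first exact: svalP.
  move=> J PJ IJ; apply: contrapT => nJI; apply: noJ.
  by exists (exist _ J PJ).
pose u n : {I | P I} := iter n g (exist _ I0 PI0).
have u_mono m n : (m <= n)%N -> sval (u m) `<=` sval (u n).
  move=> /subnK <-; elim: (n - m)%N => // k IHk.
  by apply: subset_trans IHk _; exact: (gP (u (k + m)%N)).1.
pose U : set R := [set x | exists n, sval (u n) x].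
have U0 : U 0 by exists 0%N; exact: ideal0.
have UD x y : U x -> U y -> U (x + y).
  move=> [m ux] [n uy]; exists (maxn m n); apply: idealD.
    exact: u_mono (leq_maxl m n) _ ux.
  exact: u_mono (leq_maxr m n) _ uy.
have UM a x : U x -> U (a * x) by move=> [n ux]; exists n; exact: idealM.
have [s /= Us] := noeth (Ideal U0 UD UM).
have [n sn] : exists n, [set` s] `<=` sval (u n).
  have : [set` s] `<=` U by rewrite Us => x; exact: span_set_sub.
  elim: (s) => [|x r IHr] rU; first by exists 0%N.
  have [m rm] := IHr (fun y ry => rU y (@mem_behead _ (x :: r) y ry)).
  have [n xn] := rU x (mem_head x r).
  exists (maxn m n) => y /=; rewrite inE => /orP[/eqP->|ry].
    exact: u_mono (leq_maxr m n) _ xn.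
  exact: u_mono (leq_maxl m n) _ (rm y ry).
apply: (gP (u n)).2 => x ux; apply: (span_set_min sn).
by move: Us => /= <-; exists n.+1.
Qed.

Section AdjoinElement.
Variables (I : ideal R) (x : R).

Definition adjoin_set : set R :=
  [set y | exists2 m, I m & exists r, y = m + r * x].

Fact adjoin_set0 : adjoin_set 0.
Proof. by exists 0; [exact: ideal0|exists 0; rewrite mul0r addr0]. Qed.

Fact adjoin_setD y z : adjoin_set y -> adjoin_set z -> adjoin_set (y + z).
Proof.
move=> [m Im [r ->]] [n In [s ->]]; exists (m + n); first exact: idealD.
by exists (r + s); ring.
Qed.

Fact adjoin_setM a y : adjoin_set y -> adjoin_set (a * y).
Proof.
move=> [m Im [r ->]]; exists (a * m); first exact: idealM.
by exists (a * r); ring.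
Qed.

Definition adjoin : ideal R := Ideal adjoin_set0 adjoin_setD adjoin_setM.

Lemma sub_adjoin : I `<=` adjoin.
Proof. by move=> m Im; exists m => //; exists 0; rewrite mul0r addr0. Qed.

Lemma mem_adjoin : adjoin x.
Proof. by exists 0; [exact: ideal0|exists 1; rewrite mul1r add0r]. Qed.

End AdjoinElement.

Section Saturation.
Variables (W : multset R) (I : ideal R).

Definition saturated : Prop := forall w a, W w -> I (w * a) -> I a.

(** The contraction to [R] of the localization of [I] at [W]. *)
Definition sat_set : set R := [set a | exists2 w, W w & I (w * a)].

Fact sat_set0 : sat_set 0.
Proof. by exists 1; [exact: multset1|rewrite mulr0; exact: ideal0]. Qed.

Fact sat_setD a b : sat_set a -> sat_set b -> sat_set (a + b).
Proof.
move=> [v Wv Ia] [w Ww Ib]; exists (v * w); first exact: multsetM.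
have -> : v * w * (a + b) = w * (v * a) + v * (w * b) by ring.
by apply: idealD; apply: idealM.
Qed.

Fact sat_setM a b : sat_set b -> sat_set (a * b).
Proof. by move=> [w Ww Ib]; exists w => //; rewrite mulrCA; exact: idealM. Qed.

Definition saturation : ideal R := Ideal sat_set0 sat_setD sat_setM.

Lemma sub_saturation : I `<=` saturation.
Proof. by move=> a Ia; exists 1; [exact: multset1|rewrite mul1r]. Qed.

End Saturation.

Lemma saturation_saturated W I : saturated W (saturation W I).
Proof.
move=> w a Ww [v Wv Ia]; exists (v * w); first exact: multsetM.
by rewrite -mulrA.
Qed.

(** An ideal [M] maximal among those that contain [J] and no power of [x] is prime: for [a], [b]
    outside [M], powers of [x] lie in [M + Ra] and [M + Rb], and their product lies in [M + Rab]. *)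
Lemma prime_avoiding J x : noetherian R -> ~ radical J x ->
  exists p, [/\ prime_ideal p, J `<=` p & ~ p x].
Proof.
move=> noeth nJx; pose P I := J `<=` I /\ ~ radical I x.
have [M [JM nMx] maxM] :=
  noetherian_max noeth (conj (@subset_refl _ J) nJx : P J).
have adjoinP a : ~ M a -> radical (adjoin M a) x.
  move=> nMa; apply: contrapT => nMax; apply: nMa.
  apply: maxM (mem_adjoin M a); last exact: sub_adjoin.
  by split=> //; apply: subset_trans JM _; exact: sub_adjoin.
exists M; split=> //; last by move=> Mx; apply: nMx; exists 1%N; rewrite expr1.
split=> [M1|a b Mab]; first by apply: nMx; exists 0%N; rewrite expr0.
apply: contrapT => /not_orP[].
move=> /adjoinP[m [y My [r xm]]] /adjoinP[n [z Mz [s xn]]].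
apply: nMx; exists (m + n)%N; rewrite exprD xm xn.
have -> : (y + r * a) * (z + s * b) =
  (z + s * b) * y + (r * a * z + r * s * (a * b)) by ring.
by apply: idealD; [|apply: idealD]; apply: idealM.
Qed.

Lemma prime_radical p : prime_ideal p -> radical_ideal p.
Proof.
move=> [p1 pM]; apply/seteqP; split=> x; last by exists 1%N; rewrite expr1.
case=> n; elim: n => [|n IHn]; first by rewrite expr0 => /p1.
by rewrite exprS => /pM[|/IHn].
Qed.

(** A maximal proper ideal of the form [(I : rx)] is prime: if [a] is outside it, then [(I : arx)]
    is again proper and contains it, hence equals it. *)
Lemma associated_prime I x : noetherian R -> ~ I x ->
  exists r, prime_ideal (colon I (r * x)).
Proof.
move=> noeth nIx; pose P J := exists2 r, ~ I (r * x) & J = colon I (r * x).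
have [|M [r nIrx ->] maxM] := @noetherian_max P (colon I (1 * x)) noeth.
  by exists 1; rewrite ?mul1r.
exists r; split=> [|a b]; first by rewrite !colonE mul1r.
rewrite !colonE => Iabrx; have [|nIarx] := pselect (I (a * (r * x))).
  by left.
right; apply: (maxM (colon I (a * r * x))).
- by exists (a * r); rewrite -?mulrA.
- move=> c; rewrite !colonE => Icrx.
  have -> : c * (a * r * x) = a * (c * (r * x)) by ring.
  exact: idealM.
- rewrite !colonE.
  by have -> : b * (a * r * x) = a * b * (r * x) by ring.
Qed.

Definition prime_compl p (p_prime : prime_ideal p) : multset R.
Proof.
by exists (fun x => ~ p x) => [|x y nx ny /p_prime.2[]//]; exact: p_prime.1.
Defined.

End NoetherianIdeals.

(** * Contents in Ohm-Rush algebras; weak content implies semicontent *)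

Section OhmRush.
Context {R S : comPzRingType} (phi : {rmorphism R -> S}).
Implicit Types (I J L p : ideal R) (W : multset R).
Hypotheses (R_noeth : noetherian R) (phi_flat : faithfully_flat phi)
  (phi_OR : ohm_rush phi).

Lemma content_min I g : ideal_ext phi I g -> content phi g `<=` I.
Proof. by move=> Ig a; apply. Qed.

Lemma content_subP I g : ideal_ext phi I g <-> content phi g `<=` I.
Proof.
by split=> [/content_min//|/ideal_extS gI]; apply/gI/phi_OR.
Qed.

Lemma content_mulr f g : content phi (f * g) `<=` content phi g.
Proof. exact/content_min/idealM/phi_OR. Qed.

Lemma ideal_ext_mul I J f g : ideal_ext phi I f -> ideal_ext phi J g ->
  ideal_ext phi (ideal_mul I J) (f * g).
Proof.
(* Colon ideals of [S] reduce the claim to generators, one factor at a time. *)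
move=> If Jg; suff /ideal_ext_min/(_ f If) : forall a, I a ->
    colon (ideal_ext phi (ideal_mul I J)) g (phi a) by rewrite !colonE.
move=> a Ia; suff /ideal_ext_min/(_ g Jg) : forall b, J b ->
    colon (ideal_ext phi (ideal_mul I J)) (phi a) (phi b)
  by rewrite !colonE mulrC.
move=> b Jb; rewrite !colonE -rmorphM; apply/ideal_ext_sub/span_set_sub.
by exists a, b; rewrite mulrC.
Qed.

Lemma content_mul f g :
  content phi (f * g) `<=` ideal_mul (content phi f) (content phi g).
Proof. by apply: content_min; apply: ideal_ext_mul; exact: phi_OR. Qed.

Lemma ideal_ext_colonP I x g :
  ideal_ext phi (colon I x) g <-> ideal_ext phi I (phi x * g).
Proof.
split=> [|/(ideal_ext_colon phi_flat)//]; rewrite mulrC.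
apply: (@ideal_ext_min _ _ phi _ (colon (ideal_ext phi I) (phi x))) => a Iax.
by rewrite !colonE -rmorphM; exact: ideal_ext_sub.
Qed.

Lemma ideal_ext_adjoin I x g : ideal_ext phi (adjoin I x) g ->
  exists2 l, ideal_ext phi I l & exists t, g = l + phi x * t.
Proof.
move: g; apply: ideal_ext_ind =>
  [|y z [l Il [t ->]] [m Im [u ->]]|a u [m Im [b ->]]].
- by exists 0; [exact: ideal0|exists 0; rewrite mulr0 addr0].
- exists (l + m); first exact: idealD.
  by exists (t + u); ring.
- exists (u * phi m); first exact/idealM/ideal_ext_sub.
  by exists (u * phi b); rewrite rmorphD rmorphM; ring.
Qed.

(** An element of the extension is a finite sum, so the multipliers of its terms combine into a
    single [w]. *)
Lemma ideal_ext_saturation W I g : ideal_ext phi (saturation W I) g ->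
  exists2 w, W w & ideal_ext phi I (phi w * g).
Proof.
move: g; apply: ideal_ext_ind => [|y z [v Wv Iy] [w Ww Iz]|a u [w Ww Iwa]].
- by exists 1; [exact: multset1|rewrite mulr0; exact: ideal0].
- exists (v * w); first exact: multsetM.
  have -> : phi (v * w) * (y + z) = phi w * (phi v * y) + phi v * (phi w * z).
    by rewrite rmorphM; ring.
  by apply: idealD; apply: idealM.
- exists w => //; rewrite mulrCA -rmorphM.
  exact/idealM/ideal_ext_sub.
Qed.

Lemma weak_content_saturated W L f g : weak_content_algebra phi ->
  (exists2 w, content phi f w & W w) -> saturated W L ->
  ideal_ext phi L (f * g) -> ideal_ext phi L g.
Proof.
move=> [_ weak] [w0 fw0 Ww0] satL Lfg; apply: contrapT => nLg.
pose P I := [/\ saturated W I, ideal_ext phi I (f * g) & ~ ideal_ext phi I g].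
have [M [satM Mfg nMg] maxM] :=
  @noetherian_max _ P L R_noeth (And3 satL Lfg nLg).
have [x gx nMx] : exists2 x, content phi g x & ~ M x.
  apply: contrapT => noM; apply/nMg/content_subP => x gx.
  by apply: contrapT => nMx; apply: noM; exists x.
(* Such a colon ideal again satisfies [P]: if its extension contained [g], then [x], being in
   [c(g)], would give [r * x] in [M]. *)
have colonM r : ~ M (r * x) -> colon M r `<=` M.
  move=> nMrx; apply: maxM => [|a Ma]; last exact: idealMr.
  split=> [w a Ww||].
  - by rewrite !colonE -mulrA => /satM; apply.
  - by apply: ideal_extS Mfg => a Ma; exact: idealMr.
  - by move=> /content_subP /(_ x gx); rewrite !colonE mulrC.
have p_prime : prime_ideal (colon M x).
  split=> [|a b]; rewrite !colonE ?mul1r // => Mabx.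
  have [|/colonM Ma] := pselect (M (a * x)); first by left.
  by right; apply: Ma; rewrite !colonE mulrC mulrA.
have nWx w : W w -> ~ colon M x w by move=> Ww /satM /nMx; apply.
(* This ideal is saturated and strictly larger than [M], so by maximality it can violate [P] only by
   having [g] in its extension. *)
have satx : ideal_ext phi (saturation W (adjoin M x)) g.
  apply: contrapT => nsat; apply: nMx.
  apply: (maxM (saturation W (adjoin M x))).
  - split=> //; first exact: saturation_saturated.
    by apply: ideal_extS Mfg => a /(sub_adjoin x)/(sub_saturation W).
  - by move=> a /(sub_adjoin x)/(sub_saturation W).
  - exact/sub_saturation/mem_adjoin.
have [w Ww /ideal_ext_adjoin[l Ml [t wg]]] := ideal_ext_saturation satx.
have Mxft : ideal_ext phi M (phi x * (f * t)).
  have -> : phi x * (f * t) = phi w * (f * g) - f * l.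
    by rewrite [phi w * _]mulrCA wg; ring.
  by apply: idealB; apply: idealM.
have Mxt : ideal_ext phi (colon M x) t.
  apply/content_subP => y ty.
  (* A power of [w0 * y] lies in [c(ft)], hence in the prime [(M : x)]; since [w0] is in [W] and so
     outside this prime, [y] is inside. *)
  have : radical (content phi (f * t)) (w0 * y).
    rewrite weak; exists 1%N; rewrite expr1; apply: span_set_sub.
    by exists w0, y.
  case=> n /(content_min ((ideal_ext_colonP _ _ _).2 Mxft)) Mn.
  have := prime_radical p_prime => /seteqP[/(_ (w0 * y)) + _].
  by move=> /(_ (ex_intro _ n Mn)) /p_prime.2[/(nWx _ Ww0)|].
(* Both summands of [phi w * g] lie in the extension of [M], and saturation turns [(M : w)] back
   into [M]. *)
have : ideal_ext phi (colon M w) g.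
  apply/ideal_ext_colonP; rewrite wg; apply: idealD => //.
  exact/ideal_ext_colonP.
move=> /content_subP gM; apply/nMg/content_subP => a /gM.
by rewrite !colonE mulrC => /satM; apply.
Qed.

Lemma weak_content_semicontent :
  weak_content_algebra phi -> semicontent_algebra phi.
Proof.
move=> weak; split=> // W f g fW; apply/seteqP; split=> _ [a [v [ga ->]]].
  by exists a, v; split=> //; exact: content_mulr ga.
(* The saturation of [c(fg)] provides one [w] in [W] with [w c(g)] inside [c(fg)]; a fraction [a/v]
   is then rewritten as [aw/(vw)]. *)
have /ideal_ext_saturation[w Ww /ideal_ext_colonP/content_subP gw] :
    ideal_ext phi (saturation W (content phi (f * g))) g.
  apply: weak_content_saturated weak fW _ _; first exact: saturation_saturated.
  by apply: ideal_extS (phi_OR _); exact: sub_saturation.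
have Ww' : `[< W w >] by apply/asboolP.
exists (a * w), (denomM v (Sub w Ww')); split; first exact: gw.
by apply: frac_eq1; rewrite denE [den (Sub _ _)]SubK; ring.
Qed.

End OhmRush.

(** * Contents and the McCoy property modulo an ideal *)

Section Quotients.
Context {R S : comPzRingType} (phi : {rmorphism R -> S}).
Implicit Types (I : ideal R).
Hypothesis phi_OR : ohm_rush phi.

Definition quo_preim I (J : ideal (quo I)) : ideal R.
Proof.
exists [set a | J (to_quo I a)] => [|x y Jx Jy|a x Jx] /=.
- by rewrite raddf0; exact: ideal0.
- by rewrite raddfD; exact: idealD.
- by rewrite rmorphM; exact: idealM.
Defined.

Lemma ideal_ext_quo I (J : ideal (quo I)) f :
  ideal_ext (quo_map phi I) J (to_quo _ f) <-> ideal_ext phi (quo_preim J) f.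
Proof.
split=> [Jf|]; last first.
  move: f; apply: ideal_ext_ind => [|y z Jy Jz|a u Ja].
  - by rewrite raddf0; exact: ideal0.
  - by rewrite raddfD; exact: idealD.
  - have -> : to_quo (ideal_ext phi I) (u * phi a) =
        to_quo _ u * quo_map phi I (to_quo I a) by rewrite quo_mapE rmorphM.
    by apply: idealM; exact: ideal_ext_sub.
(* Induction on the class of [f] only controls some lift [g]; the difference [g - f] lies in the
   extension of [I], which the preimage of [J] absorbs. *)
suff [g gf Jg] : exists2 g, to_quo (ideal_ext phi I) g = to_quo _ f &
    ideal_ext phi (quo_preim J) g.
  rewrite -[f](subKr g); apply: idealB => //.
  move/to_quo_eq: gf; apply: ideal_extS => a Ia.
  by rewrite /= (to_quo0P I a).2 //; exact: ideal0.
move: (to_quo _ f) Jf; apply: ideal_ext_ind =>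
  [|_ _ [x <- Jx] [y <- Jy]|a u Ja].
- by exists 0; [exact: raddf0|exact: ideal0].
- by exists (x + y); [exact: raddfD|exact: idealD].
- exists (repr u * phi (repr a)).
    by rewrite rmorphM [X in X * _]to_quo_repr.
  by apply: idealM; apply: ideal_ext_sub; rewrite /= to_quo_repr.
Qed.

Lemma quo_ohm_rush I : ohm_rush (quo_map phi I).
Proof.
move=> f; rewrite -[f]to_quo_repr; apply/ideal_ext_quo/(content_subP phi_OR).
by move=> a fa J /ideal_ext_quo/content_min; apply.
Qed.

(** Restates the property by representatives, so that later arguments stay in [R] and [S]. It rests
    on comparing the content of the class of [f] with the image of [c(f)] in [R/I]. *)
Lemma mccoy_quoP I : mccoy (quo_map phi I) <->
  forall f g, ideal_ext phi I (f * g) -> ~ ideal_ext phi I g ->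
    exists2 r, ~ I r & forall a, content phi f a -> I (r * a).
Proof.
split=> [[_ mc] f g Ifg nIg|mc].
  have [||r r0 rf] := mc (to_quo _ f) (to_quo _ g).
  - by rewrite -rmorphM; exact/to_quo0P.
  - by apply/eqP => /to_quo0P.
  move: r0 rf; rewrite -[r]to_quo_repr; move: (repr r) => {}r /eqP r0 rf.
  exists r; first by move=> /to_quo0P.
  move=> a fa; apply/to_quo0P; rewrite rmorphM; apply: rf.
  by move=> J /ideal_ext_quo/content_min; apply.
split=> [|f g]; first exact: quo_ohm_rush.
rewrite -[f]to_quo_repr -[g]to_quo_repr; move: (repr f) (repr g) => {}f {}g.
rewrite -rmorphM => /to_quo0P Ifg /eqP g0.
have [|r nIr rf] := mc f g Ifg; first by move=> /to_quo0P.
exists (to_quo I r) => [|a]; first by apply/eqP => /to_quo0P.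
(* The colon ideal here is the annihilator of the class of [r]; it contains the content of the class
   of [f] once its extension contains that class. *)
have /content_min fJ : ideal_ext (quo_map phi I)
    (colon (zero_ideal (quo I)) (to_quo I r)) (to_quo _ f).
  apply/ideal_ext_quo/(content_subP phi_OR) => b /rf Irb.
  by rewrite /= /colon_set /= -rmorphM mulrC; exact/to_quo0P.
by move=> /fJ; rewrite colonE mulrC.
Qed.

End Quotients.

(** * From semicontent to McCoy, and from McCoy at primes to weak content *)

Section Implications.
Context {R S : comPzRingType} (phi : {rmorphism R -> S}).
Hypotheses (R_noeth : noetherian R) (phi_OR : ohm_rush phi).

Lemma semicontent_residually_mccoy :
  semicontent_algebra phi -> residually_mccoy_for phi setT.
Proof.
move=> [_ _ semi]; split=> // I _; apply/(mccoy_quoP phi_OR) => f g Ifg nIg.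
have [x gx nIx] : exists2 x, content phi g x & ~ I x.
  apply: contrapT => noI; apply/nIg/(content_subP phi_OR) => x gx.
  by apply: contrapT => nIx; apply: noI; exists x.
have [r p_prime] := associated_prime R_noeth nIx.
exists (r * x) => [Irx|a fa]; first by apply: p_prime.1; rewrite colonE mul1r.
rewrite mulrC; apply: contrapT => nIarx.
pose W := prime_compl p_prime.
have fW : exists2 w, content phi f w & W w by exists a.
have : ideal_loc W (content phi g) (Defs.frac x (denom1 W))
  by exists x, (denom1 W).
have /seteqP[_ /[apply]] := semi W f g fW.
case=> b [w [fgb /frac_eq[u Wu]]]; rewrite denE mulr1 => xb.
(* Neither [u] nor [den w] lies in the prime [(I : rx)], yet their product does, because [b] lies in
   [c(fg)] and hence in [I]. *)
apply: (multsetM Wu (denomP w)); rewrite colonE.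
have -> : u * den w * (r * x) = r * (u * (x * den w)) by ring.
rewrite xb; apply: idealM; apply: idealM.
exact: content_min Ifg _ fgb.
Qed.

Lemma residually_mccoy_prime_weak_content :
  residually_mccoy_for phi (@prime_ideal R) -> weak_content_algebra phi.
Proof.
move=> [_ mc]; split=> // f g; apply/seteqP; split=> x [n].
  by move=> /(content_mul phi_OR) fgx; exists n.
move=> fgx; apply: contrapT => /(prime_avoiding R_noeth)[p [p_prime fgp npx]].
have pfg : ideal_ext phi p (f * g) by apply/(content_subP phi_OR).
suff fg_p : ideal_mul (content phi f) (content phi g) `<=` p.
  apply: npx; have /seteqP[+ _] := prime_radical p_prime; apply.
  by exists n; exact: fg_p.
apply: span_set_min => _ [a [b [fa gb ->]]].
have [/(content_subP phi_OR)/(_ b gb)|npg] := pselect (ideal_ext phi p g).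
  exact: idealM.
(* As [r] is outside the prime [p] while [r c(f)] is inside, [c(f)] lies in [p]. *)
have [r npr rf] := (mccoy_quoP phi_OR p).1 (mc p p_prime) f g pfg npg.
by have /p_prime.2[/npr//|pa] := rf a fa; exact: idealMr.
Qed.

End Implications.

Theorem theorem6 (R S : comPzRingType) (phi : {rmorphism R -> S})
    (R_noeth : noetherian R) (phi_flat : faithfully_flat phi)
    (phi_OR : ohm_rush phi) :
  [<-> weak_content_algebra phi;
       semicontent_algebra phi;
       residually_mccoy_for phi setT;
       residually_mccoy_for phi (@radical_ideal R);
       residually_mccoy_for phi (@prime_ideal R)].
Proof.
tfae.
- exact: weak_content_semicontent.
- exact: semicontent_residually_mccoy.
- by move=> [_ mc]; split=> // I _; exact: mc.
- by move=> [_ mc]; split=> // I /prime_radical; exact: mc.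
- exact: residually_mccoy_prime_weak_content.
Qed.
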